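(* Let $g\ge 1$. For every $f\in \mathrm{Sp}(g,\mathbb{Z})$ we have $$s(f)=i^{-n(f)},$$ where $s$ is the Lion–Vergne function and $n$ is the Gilmer–Masbaum function defined in the context.
   Context: Let $V=\mathbb{R}^{2g}$ with standard basis $p_1,\dots,p_g,q_1,\dots,q_g$ and symplectic form $\omega$ given by $\omega(p_i,p_j)=\omega(q_i,q_j)=0$, $\omega(p_i,q_j)=-\omega(q_i,p_j)=\delta_{ij}$. $\mathrm{Sp}(g,\mathbb{R})$ is the group of linear isometries of $(V,\omega)$; $\mathrm{Sp}(g,\mathbb{Z})\subset\mathrm{Sp}(g,\mathbb{R})$ is the subgroup preserving $\mathbb{Z}^{2g}$. A lagrangian is a subspace equal to its own $\omega$-orthogonal. Let $\lambda_0=\mathrm{span}\{p_1,\dots,p_g\}$. For $x\neq 0$ real, $\mathrm{sgn}(x)\in\{\pm1\}$ is its sign. Definition of $\epsilon$: for oriented lagrangians $\lambda_1,\lambda_2$ of a real symplectic vector space, let $\kappa=\lambda_1\cap\lambda_2$. If $\kappa=0$, $\epsilon(\lambda_1,\lambda_2)=\mathrm{sgn}(\det(\omega(a_i,b_j)))$ where $(a_i)$, $(b_j)$ are positively oriented bases of $\lambda_1$, $\lambda_2$. If $\kappa\ne0$, choose an orientation of $\kappa$; orient $\lambda_i/\kappa$ so that a positive basis of $\kappa$ followed by lifts of a positive basis of $\lambda_i/\kappa$ is a positive basis of $\lambda_i$; then $\lambda_i/\kappa$ are transverse lagrangians in the symplectic space $\kappa^\perp/\kappa$ and $\epsilon(\lambda_1,\lambda_2):=\epsilon(\lambda_1/\kappa,\lambda_2/\kappa)$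 (independent of the choice). If $\lambda_1=\lambda_2$ as subspaces, $\epsilon=1$ if the orientations agree and $-1$ otherwise. Set $s(\lambda_1,\lambda_2)=i^{\dim\lambda_1-\dim(\lambda_1\cap\lambda_2)}\epsilon(\lambda_1,\lambda_2)$, and for $f\in\mathrm{Sp}(g,\mathbb{R})$ set $s(f)=s(\lambda_0,f(\lambda_0))$, where $\lambda_0$ is given any orientation and $f(\lambda_0)$ the image orientation (the result is independent of the choice). Definition of $n$: for $f\in\mathrm{Sp}(g,\mathbb{R})$, define the bilinear form $\star_f$ on $(f-1)V$ by $a\star_f b=\omega(x,b)$ where $x$ is any vector with $(f-1)x=a$; it is nonsingular. Let $\mathrm{sgn}[\det(\star_f)]$ be the sign of the determinant of a Gram matrix of $\star_f$, with the convention $\mathrm{sgn}[\det(\star_{\mathrm{Id}})]=1$. The restriction $\star_{f,\lambda_0}$ of $\star_f$ to $\lambda_0\cap(f-1)V$ is symmetric. Define $$n(f)=\mathrm{Signature}(\star_{f,\lambda_0})-\dim((f-1)V)-\mathrm{sgn}[\det(\star_f)]+1.$$ *)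

(* Defs.v *)
From HB Require Import structures.
From mathcomp Require Import all_boot all_order all_algebra.
From mathcomp Require Import algC.
From mathcomp Require Import boolp reals.
Set Implicit Arguments. Unset Strict Implicit. Unset Printing Implicit Defensive.
Import Order.TTheory GRing.Theory Num.Theory.
Local Open Scope ring_scope.

(* V = R^(2g), vectors are row vectors 'rV_(g+g): coordinates 0..g-1 are the
   p_i, coordinates g..2g-1 are the q_i.  A linear map f is a matrix F acting
   on row vectors: f(v) = v *m F.  Subspaces are row spaces of matrices. *)

Definition symJ (R : realType) (g : nat) : 'M[R]_(g + g) :=
  block_mx 0 1%:M (- 1%:M) 0.

Definition omega (R : realType) (g : nat) (x y : 'rV[R]_(g + g)) : R :=
  (x *m symJ R g *m y^T) 0 0.

Definition is_Sp_real (R : realType) (g : nat) (F : 'M[R]_(g + g)) : Prop :=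
  F *m symJ R g *m F^T = symJ R g.

Definition is_Sp_int_entries (R : realType) (g : nat) (F : 'M[R]_(g + g)) : Prop :=
  exists Z : 'M[int]_(g + g), F = map_mx (fun z : int => z%:~R) Z.

Definition lag0 (R : realType) (g : nat) : 'M[R]_(g, g + g) := row_mx 1%:M 0.

(* An oriented lagrangian is given by a (row-free) matrix A : 'M_(g, 2g) whose
   rows form a positively oriented basis.  A basis X (of g rows) of the same
   subspace is positive iff X = P *m A with det P > 0. *)
Definition same_orient (R : realType) (g : nat) (A B : 'M[R]_(g, g + g)) : Prop :=
  exists P : 'M[R]_g, 0 < \det P /\ B = P *m A.

(* The general case of epsilon: K is a basis of kappa = lambda_1 /\ lambda_2
   (with some orientation), (K, C1) a positive basis of lambda_1 and (K, C2) a
   positive basis of lambda_2; then the classes of the rows of C1, C2 are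
   positive bases of lambda_i/kappa in kappa^perp/kappa, whose induced form is
   omega, so epsilon = sgn det(omega(c1_i, c2_j)).  [eps_general A B] says
   that some admissible choice gives the value +1 (by the independence of the
   choice, this is equivalent to epsilon = +1). *)
Definition eps_general (R : realType) (g : nat) (A B : 'M[R]_(g, g + g)) : Prop :=
  exists (k m : nat) (e : (k + m = g)%N) (K : 'M[R]_(k, g + g))
         (C1 C2 : 'M[R]_(m, g + g)) (P Q : 'M[R]_g),
    [/\ row_free K, (K == A :&: B)%MS,
        0 < \det P /\ castmx (e, erefl (g + g)%N) (col_mx K C1) = P *m A,
        0 < \det Q /\ castmx (e, erefl (g + g)%N) (col_mx K C2) = Q *m B &
        0 < \det (C1 *m symJ R g *m C2^T)].

Definition eps (R : realType) (g : nat) (A B : 'M[R]_(g, g + g)) : int :=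
  if (A == B)%MS then (if `[< same_orient A B >] then 1 else -1)
  else (if `[< eps_general A B >] then 1 else -1).

Definition s_lag (R : realType) (g : nat) (A B : 'M[R]_(g, g + g)) : algC :=
  'i ^+ (\rank A - \rank (A :&: B)%MS) * (eps A B)%:~R.

Definition s_sp (R : realType) (g : nat) (F : 'M[R]_(g + g)) : algC :=
  s_lag (lag0 R g) (lag0 R g *m F).

Definition pos_index (R : realType) (m : nat) (H : 'M[R]_m) : nat :=
  \max_(k < m.+1 | `[< exists U : 'M[R]_(k, m), row_free U /\
        forall v : 'rV[R]_m, (v <= U)%MS -> v != 0 -> 0 < (v *m H *m v^T) 0 0 >])
    (k : nat).

Definition signature (R : realType) (m : nat) (H : 'M[R]_m) : int :=
  (pos_index H)%:Z - (pos_index (- H))%:Z.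

(* Gram matrix of star_f on the span of the rows of W (rows in (f-1)V):
   entry (i,j) = omega(x_i, w_j) with x_i (f-1) = w_i. *)
Definition star_gram (R : realType) (g r : nat) (F : 'M[R]_(g + g))
    (W : 'M[R]_(r, g + g)) : 'M[R]_r :=
  (W *m pinvmx (F - 1%:M)) *m symJ R g *m W^T.

Definition sgn_det_star (R : realType) (g : nat) (F : 'M[R]_(g + g)) : int :=
  if \rank (F - 1%:M) == 0%N then 1
  else sgz (\det (star_gram F (row_base (F - 1%:M)))).

Definition n_gm (R : realType) (g : nat) (F : 'M[R]_(g + g)) : int :=
  signature (star_gram F (row_base (lag0 R g :&: (F - 1%:M))%MS))
  - (\rank (F - 1%:M))%:Z - sgn_det_star F + 1.

(* Main.v *)
Require Import Defs.
From HB Require Import structures.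
From mathcomp Require Import all_boot all_order all_algebra.
From mathcomp Require Import algC.
From mathcomp Require Import boolp reals.
From mathcomp Require Import zify ring.
Import Order.TTheory GRing.Theory Num.Theory.
Local Open Scope ring_scope.
Set Implicit Arguments. Unset Strict Implicit. Unset Printing Implicit Defensive.

(** Write M = F - 1 and beta(x, y) = omega(x, y M), the pullback of the star
    form to V, whose radical (on either side) is ker M.  Let E be the standard
    lagrangian and X = M^-1(E), the right beta-orthogonal of E; on X the form
    beta is symmetric and pulls back the restriction of the star form to
    E /\ im M.  Choose bases adapted to these subspaces:
      L0 of E /\ ker M,   L0 + L1 of E /\ X,   L0 + L1 + L2 of E,
      ker M + L1 + X2 spanning X,   Y of a complement of X + E,
    and L2' such that L0 + L1 F + L2' is a basis of E.  The vectors
    L0 + L1 F form a basis of E /\ E F.  The Gram matrix of beta with rows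
    (L1 F, L2', X2, Y) and columns (Y, L2, X2, L1) is block lower triangular,
    with diagonal blocks
      beta(L1 F, Y) = beta(Y, L1)^T,   beta(L2', L2) = omega(L2', L2 F),
      beta(X2, X2),   beta(Y, L1).
    The second block computes epsilon, the third computes the signature modulo
    4, and the determinant of the whole matrix computes sgn det of the star
    form, up to the sign of the change of basis from (L0, L1, L2) to
    (L0, L1 F, L2') and the sign (-1)^#L1 of swapping Y and L1. *)

(** * Matrix preliminaries *)

Lemma trmxD (V : nmodType) (m n : nat) (A B : 'M[V]_(m, n)) : (A + B)^T = A^T + B^T.
Proof. by apply/matrixP => i j; rewrite !mxE. Qed.

Lemma exists_row_basis (R : fieldType) (m n r : nat) (A : 'M[R]_(m, n)) :
  \rank A = r -> exists C : 'M_(r, n), row_free C /\ (C :=: A)%MS.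
Proof.
by move=> <-; exists (row_base A); split; [apply: row_base_free | apply: eq_row_base].
Qed.

(** * Inertia of symmetric matrices *)

(** Polarization: if the quadratic form vanished identically, its value at [e_i + e_j] would give
    [2 H_ij = 0]. *)
Lemma quad_neq0 (R : realFieldType) (n : nat) (H : 'M[R]_n) :
  H^T = H -> H != 0 -> exists v : 'rV_n, (v *m H *m v^T) 0 0 != 0.
Proof.
move=> Hsym H0; apply: contrapT => Hno.
have q0 (v : 'rV_n) : (v *m H *m v^T) 0 0 = 0.
  by apply/eqP/negPn/negP => vq; apply: Hno; exists v.
move/eqP: H0; apply; apply/matrixP => i j; rewrite mxE.
have := q0 (delta_mx 0 i + delta_mx 0 j).
have sym : delta_mx 0 j *m H *m (delta_mx 0 i)^T
         = (delta_mx 0 i *m H *m (delta_mx 0 j)^T : 'M_1).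
  by rewrite [RHS]mx11_scalar -tr_scalar_mx -mx11_scalar !trmx_mul Hsym trmxK mulmxA.
have Hij : (delta_mx 0 i *m H *m (delta_mx 0 j)^T : 'M_1) 0 0 = H i j.
  by rewrite -rowE trmx_delta -colE !mxE.
rewrite linearD /= mulmxDl mulmxDl !mulmxDr sym mxE [X in X + _]mxE [X in _ + X]mxE.
rewrite !q0 Hij.
by rewrite add0r addr0 -mulr2n => /eqP; rewrite mulrn_eq0 /= => /eqP.
Qed.

(** Lagrange reduction: an anisotropic vector [v] is completed to a basis, one elimination step [L]
    clears its row and column, and the Schur complement [H'] is reduced by induction. *)
Lemma sym_mx_diagonalizable (R : realFieldType) (n : nat) (H : 'M[R]_n) :
  H^T = H -> exists (P : 'M_n) (d : 'rV_n), P \in unitmx /\ P *m H *m P^T = diag_mx d.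
Proof.
elim: n H => [|n IHn] H Hsym.
  exists 1%:M, 0; split; first exact: unitmx1.
  by apply/matrixP => [[]].
have [->|H0] := eqVneq H 0.
  exists 1%:M, 0; split; first exact: unitmx1.
  by rewrite mulmx0 mul0mx; apply/matrixP => i j; rewrite !mxE mul0rn.
have [v vH] := quad_neq0 Hsym H0.
have v0 : v != 0 by apply: contraNneq vH => ->; rewrite !mul0mx mxE.
have [|C [_ eqC]] := @exists_row_basis _ _ _ n (v^C)%MS.
  by rewrite mxrank_compl rank_rV v0 subn1.
pose Q : 'M[R]_(1 + n) := col_mx v C.
have Qu : Q \in unitmx.
  rewrite -row_full_unit /row_full /Q -addsmxE (adds_eqmx (eqmx_refl v) eqC).
  exact: addsmx_compl_full.
pose a : R := (v *m H *m v^T) 0 0; pose w := C *m H *m v^T.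
have vHv : v *m H *m v^T = a%:M by rewrite [LHS]mx11_scalar.
have QHQ : Q *m H *m Q^T = block_mx a%:M w^T w (C *m H *m C^T).
  rewrite mul_col_mx tr_col_mx mul_col_row vHv.
  by rewrite !trmx_mul trmxK Hsym mulmxA.
pose L : 'M[R]_(1 + n) := block_mx 1%:M 0 (- a^-1 *: w) 1%:M.
have Lu : L \in unitmx by rewrite unitmxE det_lblock !det1 mul1r unitr1.
pose H' : 'M[R]_n := C *m H *m C^T - a^-1 *: (w *m w^T).
have LQL : L *m (Q *m H *m Q^T) *m L^T = block_mx a%:M 0 0 H'.
  rewrite QHQ tr_block_mx !mulmx_block !trmx0 !trmx1 !mul1mx !mulmx1 !mul0mx !mulmx0.
  rewrite !addr0 ?add0r.
  have aw : (- a^-1 *: w) *m a%:M + w = 0.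
    by rewrite mul_mx_scalar scalerA mulrN divff // scaleN1r addNr.
  rewrite aw !mul0mx !add0r; congr (block_mx _ _ _ _).
    transitivity ((0 : 'M[R]_(n, 1))^T); last exact: trmx0.
    by rewrite -aw linearD /=; congr (_ + _); rewrite trmx_mul tr_scalar_mx.
  by rewrite -scalemxAl scaleNr addrC.
have [|P [d [Pu PH]]] := IHn H'.
  by rewrite /H' linearB linearZ /= !trmx_mul !trmxK Hsym mulmxA.
pose P1 : 'M[R]_(1 + n) := block_mx 1%:M 0 0 P.
have P1u : P1 \in unitmx by rewrite unitmxE det_lblock det1 mul1r -unitmxE.
have dE : diag_mx (row_mx a%:M d) = block_mx a%:M 0 0 (diag_mx d).
  by rewrite diag_mx_row; congr block_mx; apply/matrixP => i j; rewrite !ord1 !mxE.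
have PP : P1 *m (L *m (Q *m H *m Q^T) *m L^T) *m P1^T = diag_mx (row_mx a%:M d).
  rewrite LQL tr_block_mx !mulmx_block !trmx0 !trmx1 !mul1mx !mulmx1 !mul0mx !mulmx0.
  by rewrite !addr0 !add0r PH dE mul0mx.
exists (P1 *m L *m Q), (row_mx a%:M d : 'rV_(1 + n)); split.
  by rewrite !unitmx_mul Lu Qu !andbT.
by rewrite -[RHS]PP !trmx_mul !mulmxA.
Qed.

Definition posdef_on (R : realType) (k m : nat) (H : 'M[R]_m) (U : 'M[R]_(k, m)) : Prop :=
  forall v : 'rV[R]_m, (v <= U)%MS -> v != 0 -> 0 < (v *m H *m v^T) 0 0.

Lemma pos_index_ge (R : realType) (k m : nat) (H : 'M[R]_m) (U : 'M[R]_(k, m)) :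
  row_free U -> posdef_on H U -> (k <= pos_index H)%N.
Proof.
move=> Ufree Upos.
have km : (k < m.+1)%N by rewrite ltnS -(eqP Ufree) rank_leq_col.
apply: (@leq_bigmax_cond _ _ _ (Ordinal km)).
by apply/asboolP; exists U.
Qed.

(** The maximum runs over a family that always contains [k = 0], realised by the empty matrix; this
    also covers the default value of the big maximum. *)
Lemma pos_index_attained (R : realType) (m : nat) (H : 'M[R]_m) :
  exists U : 'M[R]_(pos_index H, m), row_free U /\ posdef_on H U.
Proof.
rewrite /pos_index.
apply: (big_ind (fun k => exists U : 'M[R]_(k, m), row_free U /\ posdef_on H U)).
- exists 0; split; first by rewrite /row_free mxrank0.
  by move=> v /submx0null -> /eqP.
- by move=> x y hx hy; rewrite /maxn; case: ifP.
- by move=> k /asboolP.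
Qed.

(** [Q] is injective on a positive definite subspace of the pulled-back form, because that form is
    zero at any vector killed by [Q]. Hence [Q] may be rectangular or singular. *)
Lemma pos_index_congr_le (R : realType) (m n : nat) (Q : 'M[R]_(m, n)) (H : 'M[R]_n) :
  (pos_index (Q *m H *m Q^T) <= pos_index H)%N.
Proof.
have [U [Ufree Upos]] := pos_index_attained (Q *m H *m Q^T).
have UQinj (x : 'rV_(pos_index (Q *m H *m Q^T))) : x *m (U *m Q) = 0 -> x = 0.
  move=> xUQ; apply/eqP; rewrite -(mulmx_free_eq0 x Ufree).
  apply: contraTT isT => xU; have := Upos _ (submxMl x U) xU.
  by rewrite !mulmxA -(mulmxA x U Q) xUQ !mul0mx mxE ltxx.
apply: (@pos_index_ge _ _ _ H (U *m Q)).
  by rewrite -kermx_eq0; apply/rowV0P => x /sub_kermxP /UQinj.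
move=> v /submxP [x ->] xUQ.
have xU : x *m U != 0.
  by apply: contraNneq xUQ => xU; rewrite mulmxA xU mul0mx.
by have := Upos _ (submxMl x U) xU; rewrite !trmx_mul !mulmxA.
Qed.

(** The inequality is applied in both directions. [Q] and [Q'] need not be mutually inverse nor the
    sizes equal, so that vectors of the radical can be discarded. *)
Lemma pos_index_congr (R : realType) (m n : nat) (Q : 'M[R]_(m, n)) (Q' : 'M[R]_(n, m))
    (G : 'M[R]_m) (H : 'M[R]_n) :
  G = Q *m H *m Q^T -> H = Q' *m G *m Q'^T -> pos_index G = pos_index H.
Proof.
move=> GE HE; apply/eqP; rewrite eqn_leq {1}GE pos_index_congr_le /=.
by rewrite {1}HE pos_index_congr_le.
Qed.

Lemma signature_congr (R : realType) (m n : nat) (Q : 'M[R]_(m, n)) (Q' : 'M[R]_(n, m))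
    (G : 'M[R]_m) (H : 'M[R]_n) :
  G = Q *m H *m Q^T -> H = Q' *m G *m Q'^T -> signature G = signature H.
Proof.
move=> GE HE; rewrite /signature (pos_index_congr GE HE).
by congr (_ - Posz _); apply: (@pos_index_congr _ _ _ Q Q');
  rewrite !(mulmxN, mulNmx) -?GE -?HE.
Qed.

(** A positive definite and a negative definite subspace meet in 0. *)
Lemma pos_index_add_leq (R : realType) (m : nat) (H : 'M[R]_m) :
  (pos_index H + pos_index (- H) <= m)%N.
Proof.
have [U [Ufree Upos]] := pos_index_attained H.
have [V [Vfree Vneg]] := pos_index_attained (- H).
have cap0 : (U :&: V)%MS = 0.
  apply/eqP/rowV0P => v; rewrite sub_capmx => /andP [vU vV].
  apply: contraTeq isT => v0; have := Vneg v vV v0.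
  by rewrite mulmxN mulNmx mxE oppr_gt0 ltNge ltW // Upos.
rewrite -[X in (X + _)%N](eqP Ufree) -[X in (_ + X)%N](eqP Vfree).
by rewrite -mxrank_disjoint_sum // rank_leq_col.
Qed.

Lemma diag_quad (R : comNzRingType) (n : nat) (d v : 'rV[R]_n) :
  (v *m diag_mx d *m v^T) 0 0 = \sum_i d 0 i * v 0 i ^+ 2.
Proof.
rewrite mxE; apply: eq_bigr => i _.
by rewrite mul_mx_diag !mxE mulrAC mulrC expr2.
Qed.

Lemma pos_index_diag_ge (R : realType) (n : nat) (d : 'rV[R]_n) :
  (#|[pred i | (0 < d 0 i)%R]| <= pos_index (diag_mx d))%N.
Proof.
set A := [pred i | 0 < d 0 i].
pose U : 'M[R]_(#|A|, n) := rowsub enum_val 1%:M.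
have UU : U *m U^T = 1%:M.
  rewrite /U mul_rowsub_mx mul1mx; apply/matrixP => i j.
  by rewrite !mxE (inj_eq enum_val_inj) eq_sym.
apply: (@pos_index_ge _ _ _ _ U); first by apply/row_freeP; exists U^T.
move=> v vU v0.
have vout i : i \notin A -> v 0 i = 0.
  have /submxP [x ->] := vU => iA; rewrite mxE big1 // => j _.
  rewrite !mxE; case: eqP => [ji|]; last by rewrite mulr0.
  by move: iA; rewrite -ji enum_valP.
have term_ge0 i : 0 <= d 0 i * v 0 i ^+ 2.
  have [iA|/vout ->] := boolP (i \in A); last by rewrite expr0n mulr0.
  by rewrite mulr_ge0 ?sqr_ge0 // ltW.
rewrite diag_quad lt_def sumr_ge0 ?andbT //; apply: contra v0.
rewrite psumr_eq0 // => /allP all0.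
apply/eqP/rowP => i; rewrite [RHS]mxE.
have [iA|/vout //] := boolP (i \in A).
have /= := all0 i (mem_index_enum i); rewrite mulf_eq0 sqrf_eq0 => /orP [|/eqP //].
by rewrite gt_eqF.
Qed.

Lemma card_pos_neg (R : realDomainType) (n : nat) (d : 'rV[R]_n) :
    (forall i, d 0 i != 0) ->
  (#|[pred i | (0 < d 0 i)%R]| + #|[pred i | (d 0 i < 0)%R]|)%N = n.
Proof.
move=> d0; rewrite -[RHS]card_ord -(cardC [pred i | 0 < d 0 i]); congr addn.
by apply: eq_card => i; rewrite !inE -leNgt le_eqVlt (negPf (d0 i)).
Qed.

(** Coordinate subspaces bound both indices from below. These bounds already add up to [n], which is
    an upper bound for the sum of the indices, so both are equalities. *)
Lemma pos_index_diag (R : realType) (n : nat) (d : 'rV[R]_n) :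
    (forall i, d 0 i != 0) ->
  pos_index (diag_mx d) = #|[pred i | 0 < d 0 i]| /\
  pos_index (- diag_mx d) = #|[pred i | d 0 i < 0]|.
Proof.
move=> d0.
have geP := pos_index_diag_ge d.
have := pos_index_diag_ge (- d); rewrite linearN /= => geN.
have predN : [pred i | 0 < (- d) 0 i] =i [pred i | d 0 i < 0].
  by move=> i; rewrite !inE mxE oppr_gt0.
rewrite (eq_card predN) in geN.
have := pos_index_add_leq (diag_mx d).
have := card_pos_neg d0.
by move: geP geN; move: #|_| #|_| (pos_index _) (pos_index _) => p q p1 q1; lia.
Qed.

Lemma sgz_prod (R : realDomainType) (I : finType) (f : I -> R) :
  sgz (\prod_i f i) = \prod_i sgz (f i).
Proof. by elim/big_rec2: _ => [|i y1 y2 _ <-]; rewrite ?sgz1 ?sgzM. Qed.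

Lemma sgz_det_diag (R : realType) (n : nat) (d : 'rV[R]_n) :
  (forall i, d 0 i != 0) -> sgz (\det (diag_mx d)) = (-1) ^+ #|[pred i | d 0 i < 0]|.
Proof.
move=> d0; rewrite det_diag sgz_prod -[RHS]mulr1.
rewrite -prodr_const (bigID [pred i | d 0 i < 0]) /=; congr (_ * _).
  by apply: eq_bigr => i /ltr0_sgz.
by apply: big1 => i; rewrite -leNgt le_eqVlt eq_sym (negPf (d0 i)) => /gtr0_sgz.
Qed.

(** With [p] positive and [q] negative diagonal entries after reduction,
    [i^(q - p) = i^-(p + q) * i^(2q)], and [i^(2q) = (-1)^q] is the sign of the determinant. *)
Lemma exprz_signature (R : realType) (n : nat) (S : 'M[R]_n) :
    S^T = S -> S \in unitmx ->
  'i ^ (- signature S) = 'i ^- n * (sgz (\det S))%:~R :> algC.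
Proof.
move=> Ssym Su; have [P [d [Pu PS]]] := sym_mx_diagonalizable Ssym.
have SE : S = invmx P *m diag_mx d *m (invmx P)^T.
  by rewrite -PS trmx_inv !mulmxA mulVmx // mul1mx mulmxK // unitmx_tr.
have detd : \det (diag_mx d) = \det P ^+ 2 * \det S.
  by rewrite -PS !det_mulmx det_tr expr2 mulrAC.
have d0 i : d 0 i != 0.
  have : \det (diag_mx d) != 0.
    by rewrite detd mulf_neq0 // ?expf_neq0 // -unitfE -unitmxE.
  by rewrite det_diag => /prodf_neq0 ->.
have P2 : sgz (\det P ^+ 2) = 1.
  by rewrite gtr0_sgz // exprn_even_gt0 //= -unitfE -unitmxE.
have -> : sgz (\det S) = sgz (\det (diag_mx d)) by rewrite detd sgzM P2 mul1r.
rewrite (signature_congr SE (esym PS)) sgz_det_diag //.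
have [posE negE] := pos_index_diag d0.
have := card_pos_neg d0.
rewrite /signature posE negE; move: #|_| #|_| => p q <-.
rewrite opprB addrC expfzDr ?neq0Ci // -exprnN -exprnP exprD invfM -mulrA; congr (_ * _).
by rewrite rmorphXn rmorphN1 -exprVn -exprMn invCi mulrN1 opprK.
Qed.

(** * Invariance of epsilon *)

(** Since [K'] involves only [K], the matrix [T] is block lower triangular with diagonal blocks [a]
    and [v]. *)
Lemma flag_basis_change (F : fieldType) (k m n : nat) (K K' : 'M[F]_(k, n))
    (C C' : 'M[F]_(m, n)) (a : 'M[F]_k) (T : 'M[F]_(k + m)) :
    row_free (col_mx K C) -> K' = a *m K -> col_mx K' C' = T *m col_mx K C ->
  exists (u : 'M_(m, k)) (v : 'M_m), C' = u *m K + v *m C /\ \det T = \det a * \det v.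
Proof.
move=> KCfree K'E; rewrite -[T]submxK mul_block_col => /eq_col_mx [eK eC].
exists (dlsubmx T), (drsubmx T); split=> //.
have : row_mx a 0 = row_mx (ulsubmx T) (ursubmx T).
  by apply: (row_free_inj KCfree); rewrite !mul_row_col mul0mx addr0 -K'E eK.
by move=> /eq_row_mx [<- <-]; rewrite det_lblock.
Qed.

Lemma det_flag_basis_change (R : realType) (g k m : nat) (K : 'M[R]_(k, g + g))
    (C1 C2 C1' C2' : 'M[R]_(m, g + g)) (u1 u2 : 'M[R]_(m, k)) (v1 v2 : 'M[R]_m) :
    K *m symJ R g *m K^T = 0 -> K *m symJ R g *m C2^T = 0 -> C1 *m symJ R g *m K^T = 0 ->
    C1' = u1 *m K + v1 *m C1 -> C2' = u2 *m K + v2 *m C2 ->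
  \det (C1' *m symJ R g *m C2'^T) = \det v1 * \det v2 * \det (C1 *m symJ R g *m C2^T).
Proof.
move=> KK KC CK -> ->.
rewrite trmxD !trmx_mul !mulmxDl !mulmxDr !mulmxA.
rewrite -!(mulmxA u1) -!(mulmxA v1) KK CK KC !mulmxA.
rewrite !(mulmx0, mul0mx) ?add0r.
by rewrite det_mulmx det_tr -!mulmxA det_mulmx mulrAC.
Qed.

Lemma if_asbool_sgz (R : realDomainType) (P : Prop) (x : R) :
  x != 0 -> (P <-> 0 < x) -> (if `[< P >] then 1 else -1 : int) = sgz x.
Proof.
move=> x0 Px; case: asboolP => [/Px /gtr0_sgz -> //|nP].
rewrite ltr0_sgz // lt_neqAle x0 leNgt; apply/negP => /Px //.
Qed.

Section OrientedLagrangians.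

Variables (R : realType) (k m : nat).
Local Notation g := (k + m)%N.
Local Notation J := (symJ R g).
Variables (A B : 'M[R]_(g, g + g)).
Hypotheses (Afree : row_free A) (Bfree : row_free B).
Hypotheses (Aiso : A *m J *m A^T = 0) (Biso : B *m J *m B^T = 0).
Variables (K : 'M[R]_(k, g + g)) (C1 C2 : 'M[R]_(m, g + g)) (P Q : 'M[R]_g).
Hypotheses (Kfree : row_free K) (Kcap : (K == A :&: B)%MS).
Hypotheses (PA : col_mx K C1 = P *m A) (QB : col_mx K C2 = Q *m B).
Hypotheses (detP : \det P != 0) (detQ : \det Q != 0).
Hypothesis detC : \det (C1 *m J *m C2^T) != 0.

Let Pu : P \in unitmx. Proof. by rewrite unitmxE unitfE. Qed.
Let Qu : Q \in unitmx. Proof. by rewrite unitmxE unitfE. Qed.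

Let isoA a b (x : 'M_(a, g + g)) (y : 'M_(b, g + g)) :
  (x <= A)%MS -> (y <= A)%MS -> x *m J *m y^T = 0.
Proof.
move=> /submxP [x' ->] /submxP [y' ->].
by rewrite trmx_mul -!mulmxA (mulmxA A) (mulmxA _ _ y'^T) Aiso !(mul0mx, mulmx0).
Qed.

Let isoB a b (x : 'M_(a, g + g)) (y : 'M_(b, g + g)) :
  (x <= B)%MS -> (y <= B)%MS -> x *m J *m y^T = 0.
Proof.
move=> /submxP [x' ->] /submxP [y' ->].
by rewrite trmx_mul -!mulmxA (mulmxA B) (mulmxA _ _ y'^T) Biso !(mul0mx, mulmx0).
Qed.

Let orient_neq0 : \det P * \det Q * \det (C1 *m J *m C2^T) != 0.
Proof. by rewrite !mulf_neq0. Qed.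

(** Equal lagrangians force [m = 0], so the Gram determinant is the empty one, equal to 1. The basis
    change from [A] to [B] is then [Q^-1 P], whose determinant has the sign of [det P * det Q]. *)
Lemma same_orient_gt0 : (A == B)%MS ->
  same_orient A B <-> 0 < \det P * \det Q * \det (C1 *m J *m C2^T).
Proof.
move=> AB; have m0 : m = 0.
  have : \rank K = \rank A.
    rewrite (eqmxP Kcap); apply: eqmx_rank.
    by rewrite capmxSl sub_capmx submx_refl (eqmxP AB) submx_refl.
  by rewrite (eqP Kfree) (eqP Afree) => /eqP; rewrite -[X in X == _]addn0 eqn_add2l => /eqP.
have C12 : C1 = C2 by apply/matrixP => i; have := ltn_ord i; rewrite [X in (_ < X)%N]m0.
have -> : \det (C1 *m J *m C2^T) = 1.
  move: (C1 *m J *m C2^T); rewrite m0 => X; exact: det_mx00.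
have BE : B = invmx Q *m P *m A by rewrite -mulmxA -PA C12 QB mulKmx.
rewrite mulr1; have -> : (0 < \det P * \det Q) = (0 < \det (invmx Q *m P)).
  have -> : \det P * \det Q = \det (invmx Q *m P) * \det Q ^+ 2.
    by rewrite det_mulmx det_inv; field.
  by rewrite pmulr_lgt0 // exprn_even_gt0.
split=> [[T [Tpos]]|Tpos]; last by exists (invmx Q *m P).
by rewrite BE => /(row_free_inj Afree) ->.
Qed.

Lemma eps_general_of_gt0 : (0 < m)%N ->
  0 < \det P * \det Q * \det (C1 *m J *m C2^T) -> eps_general A B.
Proof.
move=> m_gt0 pos.
(* Scaling a single vector by [x] gives [det D * x = x^2]. With [x = det P] or [x = det Q], this
   makes the corresponding adapted basis positive. *)
have flipE (x : R) : x != 0 -> exists D : 'M[R]_m, 0 < \det D * x.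
  move=> x0; exists (diag_mx (\row_i (if i == Ordinal m_gt0 then x else 1))).
  rewrite det_diag (bigD1 (Ordinal m_gt0)) //= mxE eqxx big1 ?mulr1.
    by rewrite -expr2 exprn_even_gt0.
  by move=> i /negPf ni; rewrite mxE ni.
have [D1 D1P] := flipE _ detP; have [D2 D2Q] := flipE _ detQ.
have flip_col (D : 'M_m) (C : 'M_(m, g + g)) :
    col_mx K (D *m C) = block_mx 1%:M 0 0 D *m col_mx K C.
  by rewrite mul_block_col mul1mx !mul0mx addr0 add0r.
exists k, m, erefl, K, (D1 *m C1), (D2 *m C2).
exists (block_mx 1%:M 0 0 D1 *m P), (block_mx 1%:M 0 0 D2 *m Q).
split=> //.
- by rewrite castmx_id det_mulmx det_ublock det1 mul1r flip_col PA mulmxA.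
- by rewrite castmx_id det_mulmx det_ublock det1 mul1r flip_col QB mulmxA.
have -> : \det (D1 *m C1 *m J *m (D2 *m C2)^T) = \det D1 * \det D2 * \det (C1 *m J *m C2^T).
  by rewrite trmx_mul -!mulmxA det_mulmx !mulmxA det_mulmx det_tr; ring.
have pos2 := mulr_gt0 (mulr_gt0 D1P D2Q) pos.
have : 0 < (\det P * \det Q) ^+ 2 by rewrite exprn_even_gt0 ?mulf_neq0.
move=> /pmulr_rgt0 <-; move: pos2; congr (0 < _); ring.
Qed.

(** This is the independence of the choices in epsilon: [det a] enters once through each lagrangian,
    and [det v1], [det v2] enter once through an orientation and once through the Gram determinant.
    The product therefore changes by a nonzero square. *)
Lemma eps_general_gt0 : eps_general A B ->
  0 < \det P * \det Q * \det (C1 *m J *m C2^T).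
Proof.
have Ksub := Kcap; rewrite (eqmxP Kcap) in Ksub.
have [KA KB] : (K <= A)%MS /\ (K <= B)%MS.
  by apply/andP; rewrite -sub_capmx (eqmxP Kcap).
move=> [k' [m' [e [K' [C1' [C2' [P' [Q' [K'free K'cap]]]]]]]]].
have k'k : k' = k by rewrite -(eqP Kfree) -(eqP K'free) (eqmxP Kcap) (eqmxP K'cap).
subst k'; have m'm : m' = m by apply: (addnI e).
subst m'; rewrite (eq_irrelevance e erefl) !castmx_id => -[P'0 P'A] [Q'0 Q'B] C'0.
have [a K'E] : exists a, K' = a *m K.
  by apply/submxP; rewrite (eqmxP Kcap) (eqmxP K'cap).
have C1A : (C1 <= A)%MS.
  by apply: (@submx_trans _ _ _ _ _ _ (P *m A)); rewrite ?submxMl // -PA -addsmxE addsmxSr.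
have C2B : (C2 <= B)%MS.
  by apply: (@submx_trans _ _ _ _ _ _ (Q *m B)); rewrite ?submxMl // -QB -addsmxE addsmxSr.
have [||u1 [v1 [C1'E det1]]] :=
    @flag_basis_change _ _ _ _ K K' C1 C1' a (P' *m invmx P) _ K'E.
- by rewrite PA /row_free mxrankMfree // mxrank_unit.
- by rewrite P'A PA mulmxA mulmxKV.
have [||u2 [v2 [C2'E det2]]] :=
    @flag_basis_change _ _ _ _ K K' C2 C2' a (Q' *m invmx Q) _ K'E.
- by rewrite QB /row_free mxrankMfree // mxrank_unit.
- by rewrite Q'B QB mulmxA mulmxKV.
have detC' := det_flag_basis_change (isoA KA KA) (isoB KB C2B) (isoA C1A KA) C1'E C2'E.
have pos := mulr_gt0 (mulr_gt0 P'0 Q'0) C'0.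
have P'E : \det P' = \det a * \det v1 * \det P.
  by rewrite -det1 det_mulmx det_inv divfK.
have Q'E : \det Q' = \det a * \det v2 * \det Q.
  by rewrite -det2 det_mulmx det_inv divfK.
have eqn : \det P' * \det Q' * \det (C1' *m J *m C2'^T) =
    (\det a * \det v1 * \det v2) ^+ 2 * (\det P * \det Q * \det (C1 *m J *m C2^T)).
  by rewrite P'E Q'E detC'; ring.
rewrite eqn in pos.
have : 0 < (\det a * \det v1 * \det v2) ^+ 2.
  by rewrite lt_def sqr_ge0 andbT; apply: contraTneq pos => ->; rewrite mul0r ltxx.
by move=> /pmulr_rgt0 <-.
Qed.

(** The bases [(K, C1)] and [(K, C2)] may have any orientation; the signs of [det P] and [det Q]
    correct for it. *)
Lemma eps_sgz : eps A B = sgz (\det P * \det Q * \det (C1 *m J *m C2^T)).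
Proof.
rewrite /eps; case: ifP => AB; apply: if_asbool_sgz => //.
  exact: same_orient_gt0.
split; first exact: eps_general_gt0.
(* If [m = 0], both lagrangians coincide with the span of [K], which is excluded in this branch. *)
apply: eps_general_of_gt0; rewrite lt0n; apply: contraFN AB => /eqP m0.
have rk (X : 'M[R]_(g, g + g)) : row_free X -> (K <= X)%MS -> (K == X)%MS.
  move=> Xfree KX; rewrite -(geq_leqif (mxrank_leqif_eq KX)).
  by rewrite (eqP Xfree) (eqP Kfree) m0 addn0.
have /andP [KA KB] : (K <= A)%MS && (K <= B)%MS by rewrite -sub_capmx (eqmxP Kcap).
apply/eqmxP/(eqmx_trans _ (eqmxP (rk B Bfree KB)))/eqmx_sym/eqmxP.
exact: rk.
Qed.

End OrientedLagrangians.

(** * Bases adapted to a symplectic matrix *)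

Lemma col_mx_eqmx (F : fieldType) (m1 m2 m3 m4 n : nat) (A : 'M[F]_(m1, n))
    (B : 'M_(m2, n)) (A' : 'M_(m3, n)) (B' : 'M_(m4, n)) :
  (A :=: A')%MS -> (B :=: B')%MS -> (col_mx A B :=: A' + B')%MS.
Proof. by move=> AE BE; apply: eqmx_trans (eqmx_sym (addsmxE _ _)) (adds_eqmx AE BE). Qed.

Lemma addsmx_diff_eq (F : fieldType) (m1 m2 n : nat) (A : 'M[F]_(m1, n)) (B : 'M_(m2, n)) :
  (B <= A)%MS -> (B + (A :\: B)%MS :=: A)%MS.
Proof.
move=> /capmx_idPr BE; rewrite addsmxC.
exact: eqmx_trans (adds_eqmx (eqmx_refl _) (eqmx_sym BE)) (addsmx_diff_cap_eq A B).
Qed.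

(** * The standard symplectic form and lagrangian *)

Lemma trmx_symJ (R : realType) (g : nat) : (symJ R g)^T = - symJ R g.
Proof. by rewrite /symJ tr_block_mx !linearN /= !linear0 trmx1 opp_block_mx oppr0 opprK. Qed.

Lemma symJ_sqr (R : realType) (g : nat) : symJ R g *m symJ R g = - 1%:M.
Proof.
rewrite /symJ mulmx_block !mul0mx !mulmx0 mulmxN mulNmx !mulmx1 !add0r !addr0.
by rewrite -(opprK 0) -opp_block_mx oppr0 -scalar_mx_block.
Qed.

Lemma symJ_unit (R : realType) (g : nat) : symJ R g \in unitmx.
Proof.
have /mulmx1_unit [] // : symJ R g *m (- symJ R g) = 1%:M.
by rewrite mulmxN symJ_sqr opprK.
Qed.

Lemma lag0_free (R : realType) (g : nat) : row_free (lag0 R g).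
Proof.
by apply/row_freeP; exists (col_mx 1%:M 0); rewrite mul_row_col mulmx1 mul0mx addr0.
Qed.

Lemma sub_lag0P (R : realType) (g m : nat) (v : 'M[R]_(m, g + g)) :
  reflect (v *m symJ R g *m (lag0 R g)^T = 0) (v <= lag0 R g)%MS.
Proof.
rewrite -[v]hsubmxK /symJ /lag0 tr_row_mx trmx1 linear0 mul_row_block mul_row_col.
rewrite !mulmx0 mulmx1 !addr0 add0r mulmxN mulmx1.
apply: (iffP idP) => [/submxP [x]|/eqP].
  by rewrite mul_mx_row mulmx0 => /eq_row_mx [_ ->]; rewrite oppr0.
rewrite oppr_eq0 => /eqP ->.
by apply/submxP; exists (lsubmx v); rewrite mul_mx_row mulmx1 mulmx0.
Qed.

Lemma lag0_iso (R : realType) (g : nat) : lag0 R g *m symJ R g *m (lag0 R g)^T = 0.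
Proof. exact/sub_lag0P. Qed.

Lemma sub_lag0_iso (R : realType) (g a b : nat) (x : 'M[R]_(a, g + g)) (y : 'M_(b, g + g)) :
  (x <= lag0 R g)%MS -> (y <= lag0 R g)%MS -> x *m symJ R g *m y^T = 0.
Proof.
move=> /sub_lag0P xE /submxP [y' ->].
by rewrite trmx_mul !mulmxA xE mul0mx.
Qed.

(** * The form [beta], its radical and the subspace [X] *)

Section Symplectic.

Variables (R : realType) (g : nat) (F : 'M[R]_(g + g)).
Hypothesis Fsp : is_Sp_real F.

Local Notation J := (symJ R g).
Local Notation E := (lag0 R g).
Local Notation M := (F - 1%:M).
Local Notation beta := (J *m M^T).
Local Notation X := (kermx (M *m J *m E^T)).

Lemma Sp_unit : F \in unitmx.
Proof.
have /mulmx1_unit [] // : F *m (J *m F^T *m (- J)) = 1%:M.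
by rewrite !mulmxA Fsp mulmxN symJ_sqr opprK.
Qed.

(** In terms of vectors: [omega(x F, y M) = - omega(x M, y)]. *)
Lemma mul_Sp_beta : F *m beta = - (M *m J).
Proof. by rewrite linearB /= trmx1 mulmxBr mulmx1 mulmxBr mulmxA Fsp mulmxBl mul1mx opprB. Qed.

(** The defect of symmetry of [beta] is the form [omega(x M, y M)]. *)
Lemma trmx_beta : beta^T = beta + M *m beta.
Proof.
by rewrite trmx_mul trmxK trmx_symJ mulmxN -mul_Sp_beta (mulmxBl F) mul1mx addrCA subrr addr0.
Qed.

(** Writing [v = w F] gives [v beta = - w M J], so [v beta = 0] means [w M = 0]: then [w] is fixed
    by [F], and [v = w]. *)
Lemma ker_beta_sub (m : nat) (v : 'M_(m, g + g)) : (v *m beta == 0) = (v <= kermx M)%MS.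
Proof.
have FV : v = v *m invmx F *m F by rewrite mulmxKV // Sp_unit.
apply/eqP/sub_kermxP => [vb|vM].
  have wM : v *m invmx F *m M = 0.
    apply: (row_free_inj (A := J)); first by rewrite row_free_unit symJ_unit.
    rewrite mul0mx -(mulmxA _ M).
    have -> : M *m J = - (F *m beta) by rewrite mul_Sp_beta opprK.
    by rewrite mulmxN (mulmxA _ F) -FV vb oppr0.
  have -> : v = v *m invmx F.
    by move/eqP: wM; rewrite mulmxBr mulmx1 -FV subr_eq0 => /eqP.
  exact: wM.
have -> : v = v *m F by move/eqP: vM; rewrite mulmxBr mulmx1 subr_eq0 eq_sym => /eqP.
by rewrite -mulmxA mul_Sp_beta mulmxN mulmxA vM mul0mx oppr0.
Qed.

(** The kernel defining [X] is the preimage of [E] under [M] because [E] is its own orthogonal. *)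
Lemma sub_Xlag0 (m : nat) (v : 'M_(m, g + g)) : (v <= X)%MS = (v *m M <= E)%MS.
Proof.
by apply/sub_kermxP/sub_lag0P; rewrite !mulmxA.
Qed.

Lemma lag0_beta_X (a b : nat) (l : 'M_(a, g + g)) (x : 'M_(b, g + g)) :
  (l <= E)%MS -> (x <= X)%MS -> l *m beta *m x^T = 0.
Proof.
by rewrite sub_Xlag0 => lE xE; rewrite !mulmxA -mulmxA -trmx_mul sub_lag0_iso.
Qed.

(** The defect [omega(x M, y M)] vanishes here, both images lying in the isotropic [E]. *)
Lemma beta_sym_X (a b : nat) (x : 'M_(a, g + g)) (y : 'M_(b, g + g)) :
  (x <= X)%MS -> (y <= X)%MS -> (x *m beta *m y^T)^T = y *m beta *m x^T.
Proof.
rewrite !sub_Xlag0 => xE yE.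
rewrite trmx_mul trmxK (trmx_mul x) trmx_beta mulmxDl mulmxDr.
have -> : y *m (M *m beta *m x^T) = (y *m M) *m J *m (x *m M)^T.
  by rewrite trmx_mul !mulmxA.
by rewrite sub_lag0_iso // addr0 mulmxA.
Qed.

Lemma kerM_sub_X : (kermx M <= X)%MS.
Proof. by rewrite sub_Xlag0 mulmx_ker sub0mx. Qed.

(** [X] is cut out by the transpose of [E beta] up to sign, and the kernel of [beta] on [E] is
    [E /\ ker M]. So the codimension of [X] is [g - dim (E /\ ker M)]. *)
Lemma rank_X : \rank X = (g + \rank (E :&: kermx M)%MS)%N.
Proof.
have rkE : \rank (M *m J *m E^T) = \rank (E *m beta).
  by rewrite -[LHS]mxrank_tr !trmx_mul trmxK trmx_symJ mulNmx mulmxN mxrank_opp.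
have capE : (E :&: kermx beta :=: E :&: kermx M)%MS.
  apply: cap_eqmx => //; apply/eqmxP.
  by rewrite -ker_beta_sub mulmx_ker eqxx; apply/sub_kermxP/eqP; rewrite ker_beta_sub.
have := mxrank_mul_ker E beta; rewrite capE (eqP (lag0_free R g)).
rewrite mxrank_ker rkE; move: (\rank _) (\rank _) => a b. lia.
Qed.

(** For [x] in [E], the equality [x F = x M + x] shows that [x F] is in [E] exactly when [x M]
    is. *)
Lemma image_lag0_X : ((E :&: X) *m F :=: E :&: (E *m F))%MS.
Proof.
have FE (v : 'rV_(g + g)) : v *m F = v *m M + v by rewrite mulmxBr mulmx1 subrK.
apply/eqmxP/andP; split; apply/rV_subP => v.
  move=> /submxP [x ->]; rewrite mulmxA; set w := x *m _.
  have : (w <= E :&: X)%MS by exact: submxMl.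
  rewrite sub_capmx sub_Xlag0 => /andP [wE wME].
  by rewrite sub_capmx submxMr // andbT FE addmx_sub.
rewrite sub_capmx => /andP [vE /submxP [x vx]].
rewrite vx mulmxA submxMr // sub_capmx submxMl sub_Xlag0.
have -> : x *m E *m M = v - x *m E by rewrite vx mulmxBr mulmx1 mulmxA.
by rewrite addmx_sub // eqmx_opp submxMl.
Qed.

(** Each family is a basis of a relative complement, with [z = dim (E /\ ker M)] and
    [z + h = dim (E /\ X)]. The rank count and the last clause together say that [(L1, L2, X2, Y)]
    is a basis of [V] modulo [ker M]. *)
Lemma adapted_bases : exists (z h m rho : nat) (L0 : 'M[R]_(z, g + g))
    (L1 : 'M[R]_(h, g + g)) (L2 L2' : 'M[R]_(m, g + g))
    (X2 : 'M[R]_(rho, g + g)) (Y : 'M[R]_(h, g + g)),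
  [/\ (z + h + m = g)%N, (h + m + (rho + h) = \rank M)%N, L0 *m M = 0,
      (L1 <= X)%MS & (X2 <= X)%MS] /\
  [/\ (col_mx (col_mx L0 L1) L2 :=: E)%MS,
      (col_mx L0 (L1 *m F) :=: E :&: (E *m F))%MS,
      (col_mx (col_mx L0 (L1 *m F)) L2' :=: E)%MS,
      (X <= kermx M + (L1 + X2))%MS &
      (col_mx (col_mx L1 L2) (col_mx X2 Y) *m M :=: M)%MS].
Proof.
pose K := kermx M; pose EK := (E :&: K)%MS; pose EX := (E :&: X)%MS.
pose z := \rank EK; pose k := \rank EX.
have EKX : (EK <= EX)%MS by rewrite capmxS // kerM_sub_X.
have capEKX : (EX :&: EK :=: EK)%MS by apply/capmx_idPr.
have rkE : \rank E = g := eqP (lag0_free R g).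
have le_kg : (k <= g)%N by rewrite -[X in (_ <= X)%N]rkE mxrankS // capmxSl.
have rkcap : \rank (EX :&: EK)%MS = z by rewrite capEKX.
have capEEX : (E :&: EX :=: EX)%MS by apply/capmx_idPr/capmxSl.
have rkX := rank_X; rewrite -/K -/EK -/z in rkX.
have rkF : \rank (E :&: (E *m F))%MS = k.
  by rewrite -image_lag0_X mxrankMfree // row_free_unit Sp_unit.
have [|L0 [_ L0E]] := @exists_row_basis _ _ _ z EK; first by [].
have [|L1 [_ L1E]] := @exists_row_basis _ _ _ (k - z)%N (EX :\: EK)%MS.
  have := mxrank_cap_compl EX EK; rewrite rkcap -/k; lia.
have [|L2 [_ L2E]] := @exists_row_basis _ _ _ (g - k)%N (E :\: EX)%MS.
  by have := mxrank_cap_compl E EX; rewrite capEEX -/k rkE; lia.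
have [|L2' [_ L2'E]] := @exists_row_basis _ _ _ (g - k)%N (E :\: (E :&: (E *m F)))%MS.
  have := mxrank_cap_compl E (E :&: (E *m F))%MS.
  suff -> : \rank (E :&: (E :&: E *m F))%MS = k by rewrite rkE; lia.
  by rewrite (capmx_idPr (capmxSl _ _)).
have [X2 [_ X2E]] := exists_row_basis (erefl (\rank (X :\: (K + EX))%MS)).
have rkXE : (\rank (X + E)%MS = g + z + g - k)%N.
  have := mxrank_sum_cap X E; rewrite capmxC -/EX -/k rkX rkE; lia.
have le_zk : (z <= k)%N by exact: mxrankS.
(* [Y] has as many rows as [L1], since [dim (X + E) = 2g - (k - z)]; the block pairing [Y] with [L1]
   is thus square. *)
have [|Y [_ YE]] := @exists_row_basis _ _ _ (k - z)%N (X + E)^C%MS.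
  by rewrite mxrank_compl rkXE; lia.
have EX01 : (col_mx L0 L1 :=: EX)%MS.
  exact: eqmx_trans (col_mx_eqmx L0E L1E) (addsmx_diff_eq EKX).
have L0M : L0 *m M = 0 by apply/sub_kermxP; rewrite L0E capmxSr.
(* [F] fixes [L0], so the [F]-image of the basis of [E /\ X] still begins with [L0]. *)
have L01F : col_mx L0 (L1 *m F) = col_mx L0 L1 *m F.
  rewrite mul_col_mx; congr col_mx.
  by apply/eqP; rewrite eq_sym -subr_eq0 -L0M mulmxBr mulmx1.
have kapE : (col_mx L0 (L1 *m F) :=: E :&: (E *m F))%MS.
  by rewrite L01F; apply: eqmx_trans (eqmxMr F EX01) image_lag0_X.
have L1X : (L1 <= X)%MS.
  by rewrite L1E (submx_trans (diffmxSl _ _)) // capmxSr.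
have X2X : (X2 <= X)%MS by rewrite X2E diffmxSl.
have KEX_X : (K + EX <= X)%MS by rewrite addsmx_sub kerM_sub_X capmxSr.
have EX_KL1 : (EX <= K + L1)%MS.
  rewrite -EX01 -addsmxE addsmxS // L0E; exact: capmxSr.
have XE : (X <= K + (L1 + X2))%MS.
  rewrite -(addsmx_diff_eq KEX_X) addsmxA addsmxS ?X2E //.
  by rewrite addsmx_sub addsmxSl EX_KL1.
exists z, (k - z)%N, (g - k)%N, _, L0, L1, L2, L2', X2, Y; split; split=> //.
- lia.
- have rkK := mxrank_ker M; rewrite -/K in rkK.
  have := mxrank_sum_cap K EX; have := mxrank_cap_compl X (K + EX)%MS.
  have -> : \rank (X :&: (K + EX))%MS = \rank (K + EX)%MS by rewrite (capmx_idPr KEX_X).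
  have -> : \rank (K :&: EX)%MS = z.
    by rewrite capmxC -capmxA (cap_eqmx (eqmx_refl _) (capmx_idPr kerM_sub_X)).
  have := rank_leq_row M; rewrite rkK rkX -/k.
  move: (\rank (X :\: _)) (\rank (_ + _)%MS) (\rank M) => a b r; lia.
- apply: eqmx_trans (col_mx_eqmx EX01 L2E) (addsmx_diff_eq _); exact: capmxSl.
- apply: eqmx_trans (col_mx_eqmx kapE L2'E) (addsmx_diff_eq _); exact: capmxSl.
set Z := col_mx _ _.
apply/eqmxP; rewrite submxMl /=.
have LZ : (col_mx L1 L2 <= Z)%MS by rewrite -(addsmxE _ (col_mx X2 Y)) addsmxSl.
have XZ : (col_mx X2 Y <= Z)%MS by rewrite -(addsmxE (col_mx L1 L2)) addsmxSr.
have L1Z : (L1 <= Z)%MS by apply: submx_trans LZ; rewrite -addsmxE addsmxSl.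
have L2Z : (L2 <= Z)%MS by apply: submx_trans LZ; rewrite -addsmxE addsmxSr.
have X2Z : (X2 <= Z)%MS by apply: submx_trans XZ; rewrite -addsmxE addsmxSl.
have YZ : (Y <= Z)%MS by apply: submx_trans XZ; rewrite -addsmxE addsmxSr.
have XKZ : (X <= K + Z)%MS.
  by apply: submx_trans XE _; rewrite addsmxS // addsmx_sub L1Z X2Z.
(* [V = X + E + Y], where [X] lies in [K + Z] and [E] is spanned by [E /\ X] and [L2]. Applying [M]
   then kills [K]. *)
have : (1%:M <= K + Z)%MS.
  apply: (@submx_trans _ _ _ _ _ _ (X + E + Y)%MS).
    by rewrite (adds_eqmx (eqmx_refl _) YE) submx_full // addsmx_compl_full.
  rewrite !addsmx_sub XKZ (submx_trans YZ (addsmxSr _ _)) andbT /=.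
  have EXE : (EX <= E)%MS by exact: capmxSl.
  rewrite -(addsmx_diff_eq EXE) addsmx_sub (submx_trans (capmxSr _ _) XKZ) -L2E.
  by rewrite (submx_trans L2Z) // addsmxSr.
move=> /(submxMr M); rewrite mul1mx => /submx_trans; apply.
by rewrite addsmxMr mulmx_ker adds0mx.
Qed.

End Symplectic.

(** * Gram determinants of the star form *)

Lemma det_castmx (R : comNzRingType) (a b : nat) (e : a = b) (A : 'M[R]_a) :
  \det (castmx (e, e) A) = \det A.
Proof. by case: _ / e; rewrite castmx_id. Qed.

Lemma castmx_mull (R : pzRingType) (a b n : nat) (e : a = b) (T : 'M[R]_a) (A : 'M_(a, n)) :
  castmx (e, erefl) (T *m A) = castmx (e, e) T *m castmx (e, erefl) A.
Proof. by case: _ / e; rewrite !castmx_id. Qed.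

(** After reassociating the blocks, both bases start with the same [A], so the flag lemma applies
    with the identity on [A]. *)
Lemma flag_basis_change_assoc (F : fieldType) (z h m n : nat) (A : 'M[F]_(z, n))
    (B B' : 'M_(h, n)) (C C' : 'M_(m, n)) (T : 'M_(z + h + m)) :
    row_free (col_mx (col_mx A B) C) ->
    col_mx (col_mx A B') C' = T *m col_mx (col_mx A B) C ->
  exists (u : 'M_(h + m, z)) (v : 'M_(h + m)),
    col_mx B' C' = u *m A + v *m col_mx B C /\ \det T = \det v.
Proof.
move=> ABC eT; pose e := esym (addnA z h m).
have assoc (X : 'M[F]_(h, n)) (Y : 'M_(m, n)) :
    castmx (e, erefl) (col_mx (col_mx A X) Y) = col_mx A (col_mx X Y).
  by rewrite col_mxA.
have [|||u [v [eu ev]]] := @flag_basis_change F z (h + m) n A A (col_mx B C) (col_mx B' C')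
  1%:M (castmx (e, e) T).
- by rewrite -assoc /row_free eqmx_cast (eqP ABC) addnA.
- by rewrite mul1mx.
- by rewrite -!assoc eT castmx_mull.
by exists u, v; rewrite -(det_castmx e T) ev det1 mul1r.
Qed.

Lemma square_coord_unit (F : fieldType) (g n : nat) (A B : 'M[F]_(g, n)) :
  row_free B -> (A :=: B)%MS -> exists2 P, P \in unitmx & A = P *m B.
Proof.
move=> Bfree AB; have /submxP [P AP] : (A <= B)%MS by rewrite AB.
exists P => //; rewrite -row_free_unit /row_free -(mxrankMfree P Bfree) -AP AB.
exact: Bfree.
Qed.

Lemma swap_outer_blocks (R : comNzRingType) (h m p n : nat) (A D : 'M[R]_(h, n))
    (B : 'M_(m, n)) (C : 'M_(p, n)) :
  exists2 S : 'M_(h + m + (p + h)), \det S = (-1) ^+ h &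
    col_mx (col_mx D B) (col_mx C A) = S *m col_mx (col_mx A B) (col_mx C D).
Proof.
(* (a, d) |-> (a + d, d) |-> (a + d, - a) |-> (d, - a) |-> (d, a) *)
pose N : 'M[R]_(h + m, p + h) := block_mx 0 1%:M 0 0.
pose N' : 'M[R]_(p + h, h + m) := block_mx 0 0 (- 1%:M) 0.
pose U := block_mx 1%:M N 0 1%:M; pose V := block_mx 1%:M 0 N' 1%:M.
pose W : 'M[R]_(p + h) := block_mx 1%:M 0 0 (- 1%:M).
exists (block_mx 1%:M 0 0 W *m U *m V *m U).
  rewrite !det_mulmx /U /V /W !(det_lblock, det_ublock) !det1 !mul1r !mulr1.
  by rewrite -scaleN1r detZ det1 mulr1.
pose Q (a d : 'M[R]_(h, n)) := col_mx (col_mx a B) (col_mx C d).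
have UE a d : U *m Q a d = Q (a + d) d.
  rewrite !mul_block_col !mul0mx !mul1mx !add0r.
  by rewrite add_col_mx addr0.
have VE a d : V *m Q a d = Q a (d - a).
  rewrite !mul_block_col !mul0mx !mul1mx mulNmx mul1mx !(addr0, add0r).
  by rewrite add_col_mx add0r addrC.
have WE a d : block_mx 1%:M 0 0 W *m Q a d = Q a (- d).
  by rewrite !mul_block_col !mul0mx !mul1mx mulNmx mul1mx !(addr0, add0r).
rewrite -/(Q A D) -!mulmxA UE VE UE WE -/(Q D A); congr Q.
  by rewrite addrC subrK.
by rewrite opprB addrK.
Qed.

Lemma sgz_eq_of_mul_gt0 (R : realDomainType) (x y : R) : 0 < x * y -> sgz x = sgz y.
Proof.
case: (ltgtP x 0) => [x0|x0|->].
- by rewrite nmulr_rgt0 // => y0; rewrite !ltr0_sgz.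
- by rewrite pmulr_rgt0 // => y0; rewrite !gtr0_sgz.
- by rewrite mul0r ltxx.
Qed.

Lemma det_block_lower4 (R : comNzRingType) (h m p : nat) (D G : 'M[R]_h) (B : 'M_m) (S : 'M_p)
    (b : 'M_(m, h)) (s : 'M_(h, p)) (c : 'M_(p + h, h + m)) :
  \det (block_mx (block_mx D 0 b B) 0 c (block_mx S 0 s G)) =
  \det D * \det B * (\det S * \det G).
Proof. by rewrite !det_lblock. Qed.

Lemma det_mx0 (R : comNzRingType) (r : nat) (A : 'M[R]_r) : r = 0%N -> \det A = 1.
Proof. by move=> r0; subst r; exact: det_mx00. Qed.

Lemma sgz_det_gram_basis (F : realFieldType) (a b n : nat)
    (U : 'M[F]_(a, n)) (V : 'M_(b, n)) (H : 'M_n) :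
    row_free U -> row_free V -> (U :=: V)%MS ->
  sgz (\det (U *m H *m U^T)) = sgz (\det (V *m H *m V^T)).
Proof.
move=> Ufree Vfree UV; have ab : a = b by rewrite -(eqP Ufree) -(eqP Vfree) UV.
subst b; have [P Pu UE] := square_coord_unit Vfree UV.
have -> : U *m H *m U^T = P *m (V *m H *m V^T) *m P^T.
  by rewrite {1 2}UE trmx_mul !mulmxA.
rewrite !det_mulmx det_tr mulrAC -expr2 sgzM gtr0_sgz ?mul1r //.
by rewrite exprn_even_gt0 //= -unitfE -unitmxE.
Qed.

Lemma row_free_col_mx_l (F : fieldType) (a b n : nat) (A : 'M[F]_(a, n)) (B : 'M_(b, n)) :
  row_free (col_mx A B) -> row_free A.
Proof.
move=> ABfree; rewrite /row_free eqn_leq rank_leq_row /= -(leq_add2r b).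
rewrite -[X in (X <= _)%N](eqP ABfree) -addsmxE (leq_trans (mxrank_adds_leqif _ _)) //.
by rewrite leq_add2l rank_leq_row.
Qed.

Section StarForm.

Variables (R : realType) (g : nat) (F : 'M[R]_(g + g)).
Hypothesis Fsp : is_Sp_real F.

Local Notation J := (symJ R g).
Local Notation E := (lag0 R g).
Local Notation M := (F - 1%:M).
Local Notation beta := (J *m M^T).
Local Notation X := (kermx (M *m J *m E^T)).

(** The preimage chosen by [pinvmx] differs from [Z] by vectors of [ker M], which [beta] kills. *)
Lemma star_gram_preimage (r : nat) (Z W : 'M_(r, g + g)) :
  W = Z *m M -> star_gram F W = Z *m beta *m Z^T.
Proof.
move=> ->; rewrite /star_gram; set Y := _ *m pinvmx _.
have : (Y - Z) *m beta = 0.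
  apply/eqP; rewrite ker_beta_sub //; apply/sub_kermxP.
  by rewrite mulmxBl mulmxKpV ?submxMl // subrr.
by rewrite mulmxBl => /subr0_eq <-; rewrite trmx_mul !mulmxA.
Qed.

Lemma sgn_det_starE (r : nat) (Z : 'M_(r, g + g)) :
    row_free (Z *m M) -> (Z *m M :=: M)%MS ->
  sgn_det_star F = sgz (\det (Z *m beta *m Z^T)).
Proof.
move=> ZMfree ZM; rewrite -(star_gram_preimage (erefl (Z *m M))) /sgn_det_star.
have -> : sgz (\det (star_gram F (Z *m M))) = sgz (\det (star_gram F (row_base M))).
  rewrite /star_gram -!(mulmxA _ (pinvmx _)).
  apply: sgz_det_gram_basis; rewrite ?row_base_free //.
  by apply: eqmx_trans ZM (eqmx_sym (eq_row_base _)).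
(* In rank 0 the empty determinant agrees with the convention for the identity. *)
by case: eqP => // r0; rewrite det_mx0 ?sgz1.
Qed.

(** As [M] factors through [Z M], a kernel vector [x] of the Gram matrix gives [x Z] in the radical
    [ker M] of [beta], whence [x Z M = 0]. *)
Lemma det_star_neq0 (r : nat) (Z : 'M_(r, g + g)) :
    row_free (Z *m M) -> (Z *m M :=: M)%MS -> \det (Z *m beta *m Z^T) != 0.
Proof.
move=> ZMfree ZM; rewrite -unitfE -unitmxE -row_free_unit -kermx_eq0.
apply/rowV0P => x /sub_kermxP xG.
have /submxP [Q MQ] : (M <= Z *m M)%MS by rewrite ZM.
have /eqP : x *m Z *m beta = 0.
  have -> : beta = beta *m Z^T *m Q^T by rewrite {1}MQ !trmx_mul !mulmxA.
  by move: xG; rewrite !mulmxA => ->; rewrite mul0mx.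
rewrite ker_beta_sub // => /sub_kermxP; rewrite -mulmxA => xZM.
by apply: (row_free_inj ZMfree); rewrite xZM mul0mx.
Qed.

(** On [X] both [ker M] and [L1] lie in the radical of [beta], so only the [X2] components of
    preimages of [E /\ im M] count. Some radical may remain in either Gram matrix; [c] and [Q]
    merely transport one form to the other. *)
Lemma signature_star_lag0 (h p : nat) (L1 : 'M_(h, g + g)) (X2 : 'M_(p, g + g)) :
    (L1 <= E)%MS -> (L1 <= X)%MS -> (X2 <= X)%MS -> (X <= kermx M + (L1 + X2))%MS ->
  signature (star_gram F (row_base (E :&: M)%MS)) = signature (X2 *m beta *m X2^T).
Proof.
move=> L1E L1X X2X XE; set W := row_base _.
have WcapE : (W :=: E :&: M)%MS := eq_row_base _.
have WE : (W <= E)%MS by rewrite WcapE capmxSl.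
have /submxP [w wM] : (W <= M)%MS by rewrite WcapE capmxSr.
have wX : (w <= X)%MS by rewrite sub_Xlag0 -wM.
rewrite (star_gram_preimage wM).
have /submxP [Q X2Q] : (X2 *m M <= W)%MS.
  by rewrite WcapE sub_capmx submxMl andbT -sub_Xlag0.
have /sub_addsmxP [[a bc] /= wE] : (w <= kermx M + (L1 + X2))%MS := submx_trans wX XE.
have /sub_addsmxP [[b c] /= bcE] : (bc *m (L1 + X2)%MS <= L1 + X2)%MS by exact: submxMl.
have wT : w^T = (a *m kermx M)^T + (L1^T *m b^T + X2^T *m c^T).
  by rewrite wE bcE -!trmx_mul; apply/matrixP => i j; rewrite !mxE.
have kerL (m : nat) (y : 'M_(m, g + g)) : beta *m (y *m kermx M)^T = 0.
  by rewrite -mulmxA -trmx_mul -mulmxA mulmx_ker mulmx0 trmx0 mulmx0.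
have betaX (m : nat) (y : 'M_(m, g + g)) :
    (y <= X)%MS -> y *m beta *m w^T = y *m beta *m X2^T *m c^T.
  move=> yX; rewrite wT !mulmxDr -(mulmxA y) kerL mulmx0 add0r.
  rewrite mulmxA -[y *m _ *m L1^T]trmxK beta_sym_X // lag0_beta_X //.
  by rewrite trmx0 mul0mx add0r mulmxA.
apply: (@signature_congr _ _ _ c Q).
  rewrite betaX // -[w *m beta *m X2^T]trmxK beta_sym_X // betaX // trmx_mul trmxK.
  by rewrite beta_sym_X // mulmxA.
(* [Q w] and [X2] have the same image under [M], so they agree modulo the radical. *)
have : (Q *m w - X2) *m beta = 0.
  apply/eqP; rewrite ker_beta_sub //; apply/sub_kermxP.
  by rewrite mulmxBl -mulmxA -wM X2Q subrr.
rewrite mulmxBl => /subr0_eq QX.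
rewrite !(mulmxA Q) QX -[RHS]trmxK (trmx_mul _ Q^T) trmxK beta_sym_X //.
by rewrite !(mulmxA Q) QX beta_sym_X.
Qed.

End StarForm.

(** * The determinant identity for adapted bases *)

Lemma det_gram_lower4 (R : comNzRingType) (n h m p : nat) (b : 'M[R]_n) (A A' D : 'M_(h, n))
    (B B' : 'M_(m, n)) (C : 'M_(p, n)) :
    A' *m b *m B^T = 0 -> A' *m b *m C^T = 0 -> A' *m b *m A^T = 0 ->
    B' *m b *m C^T = 0 -> B' *m b *m A^T = 0 -> C *m b *m A^T = 0 ->
  \det (col_mx (col_mx A' B') (col_mx C D) *m b *m (col_mx (col_mx D B) (col_mx C A))^T) =
  \det (A' *m b *m D^T) * \det (B' *m b *m B^T) *
    (\det (C *m b *m C^T) * \det (D *m b *m A^T)).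
Proof.
move=> AB AC AA BC BA CA.
rewrite (mul_col_mx (col_mx A' B')) (mul_col_mx A') (mul_col_mx C) !tr_col_mx.
rewrite mul_col_row !mul_col_row AB AC AA BC BA CA.
by rewrite block_mx0 det_block_lower4.
Qed.

Section DetIdentity.

Variables (R : realType) (g : nat) (F : 'M[R]_(g + g)).
Hypothesis Fsp : is_Sp_real F.

Local Notation J := (symJ R g).
Local Notation E := (lag0 R g).
Local Notation M := (F - 1%:M).
Local Notation beta := (J *m M^T).
Local Notation X := (kermx (M *m J *m E^T)).

(** The term [u L0] is killed by [beta], so passing to the rows [(L1 F, L2')] costs only [det v],
    and swapping [L1] with [Y] in the columns costs [(-1)^h]. The two outer diagonal blocks are
    transposes of each other, which produces the square. *)
Lemma det_beta_adapted (z h m p : nat) (L0 : 'M_(z, g + g)) (L1 Y : 'M_(h, g + g))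
    (L2 L2' : 'M_(m, g + g)) (X2 : 'M_(p, g + g)) (u : 'M_(h + m, z)) (v : 'M_(h + m)) :
    L0 *m M = 0 -> (L1 <= E)%MS -> (L1 <= X)%MS -> (X2 <= X)%MS ->
    (L2 <= E)%MS -> (L2' <= E)%MS ->
    col_mx (L1 *m F) L2' = u *m L0 + v *m col_mx L1 L2 ->
    let Z := col_mx (col_mx L1 L2) (col_mx X2 Y) in
  \det v * (-1) ^+ h * \det (Z *m beta *m Z^T) =
  \det (Y *m beta *m L1^T) ^+ 2 * \det (L2' *m beta *m L2^T) * \det (X2 *m beta *m X2^T).
Proof.
move=> L0M L1E L1X X2X L2E L2'E uv Z.
have L1ME : (L1 *m M <= E)%MS by rewrite -sub_Xlag0.
have L1FE : (L1 *m F <= E)%MS.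
  have -> : L1 *m F = L1 *m M + L1 by rewrite mulmxBr mulmx1 subrK.
  exact: addmx_sub.
pose ZL := col_mx (col_mx (L1 *m F) L2') (col_mx X2 Y).
have L1Fb : L1 *m F *m beta = - (L1 *m M *m J).
  by rewrite -!mulmxA (mul_Sp_beta Fsp) mulmxN mulmxA.
have [S detS SZ] := swap_outer_blocks L1 Y L2 X2; rewrite -/Z in SZ.
have uL0b : u *m L0 *m beta = 0.
  apply/eqP; rewrite ker_beta_sub //; apply/sub_kermxP.
  by rewrite -mulmxA L0M mulmx0.
have ZLb : ZL *m beta = block_mx v 0 0 1%:M *m Z *m beta.
  rewrite /ZL uv mul_block_col !mul0mx mul1mx add0r addr0.
  (* [mul_col_mx] would otherwise unfold the block matrix [J] inside [beta]. *)
  by move: uL0b; move: (beta) => b uL0b; rewrite 2!mul_col_mx mulmxDl uL0b add0r !mul_col_mx.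
have -> : \det v * (-1) ^+ h * \det (Z *m beta *m Z^T) =
    \det (ZL *m beta *m (S *m Z)^T).
  have -> : ZL *m beta *m (S *m Z)^T = block_mx v 0 0 1%:M *m (Z *m beta *m Z^T) *m S^T.
    by rewrite ZLb (trmx_mul S) !mulmxA.
  by rewrite !(det_mulmx _ S^T) det_mulmx det_ublock det1 mulr1 det_tr detS mulrAC.
have sx0 (a b : nat) (x : 'M_(a, g + g)) (y : 'M_(b, g + g)) :
  (x <= X)%MS -> (y <= X)%MS -> (y <= E)%MS -> x *m beta *m y^T = 0.
  by move=> xX yX yE; rewrite -[LHS]trmxK beta_sym_X // lag0_beta_X // trmx0.
have L1F0 (a : nat) (y : 'M_(a, g + g)) : (y <= E)%MS -> L1 *m F *m beta *m y^T = 0.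
  by move=> yE; rewrite L1Fb mulNmx sub_lag0_iso // oppr0.
have L1FY : L1 *m F *m beta *m Y^T = (Y *m beta *m L1^T)^T.
  by rewrite L1Fb !trmx_mul !trmxK trmx_symJ !(mulmxN, mulNmx) !mulmxA.
rewrite -SZ det_gram_lower4.
- by rewrite L1FY det_tr; ring.
- exact: L1F0.
- exact: lag0_beta_X.
- exact: lag0_beta_X.
- exact: lag0_beta_X.
- exact: lag0_beta_X.
- exact: sx0.
Qed.

End DetIdentity.

(** * Powers of [i] and comparison of signs *)

Lemma sgz_sign (R : realDomainType) (h : nat) : sgz ((-1) ^+ h : R) = (-1) ^+ h.
Proof. by elim: h => [|h IHh]; rewrite ?expr0 ?sgz1 // !exprS sgzM sgzN sgz1 IHh. Qed.

Lemma exprzi_sgz_sub1 (R : realDomainType) (x : R) :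
  x != 0 -> 'i ^ (sgz x - 1) = (sgz x)%:~R :> algC.
Proof.
case: (ltgtP x 0) => // x0 _; first rewrite ltr0_sgz // rmorphN1.
  by rewrite -[-1 - 1]/(- 2%:Z) -exprnN sqrCi invrN1.
by rewrite gtr0_sgz // subrr expr0z.
Qed.

(** The rank is [p + m + 2h]: [i^p] cancels the [i^-p] coming from the signature, [i^(2h)] becomes
    [(-1)^h], and [i^m] remains. *)
Lemma exprzi_n_gm (R : realType) (g h m p : nat) (F : 'M[R]_(g + g)) (S : 'M[R]_p) (d : R) :
    signature (star_gram F (row_base (lag0 R g :&: (F - 1%:M))%MS)) = signature S ->
    S^T = S -> S \in unitmx -> (h + m + (p + h))%N = \rank (F - 1%:M) ->
    d != 0 -> sgn_det_star F = sgz d ->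
  'i ^ (- n_gm F) = 'i ^+ m * (sgz ((-1) ^+ h * \det S * d))%:~R :> algC.
Proof.
move=> sigE Ssym Su rk d0 sgnE; rewrite /n_gm sigE sgnE -rk.
have -> : - (signature S - (h + m + (p + h))%N%:Z - sgz d + 1) =
    - signature S + (h + m + (p + h))%N%:Z + (sgz d - 1) by ring.
have expD (a b : int) : 'i ^ (a + b) = 'i ^ a * 'i ^ b :> algC by rewrite expfzDr ?neq0Ci.
rewrite expD (expD (- signature S)) exprzi_sgz_sub1 // exprz_signature // -exprnP.
have -> : (h + m + (p + h))%N = (p + (m + 2 * h))%N by lia.
rewrite exprD exprD exprM sqrCi !sgzM sgz_sign !rmorphM rmorphXn rmorphN1 /=.
have ip : 'i ^+ p != 0 :> algC by rewrite expf_neq0 // neq0Ci.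
by field.
Qed.

Unset Implicit Arguments.

Theorem theorem1p1 (R : realType) (g : nat) (F : 'M[R]_(g + g)) :
  (0 < g)%N -> is_Sp_real F -> is_Sp_int_entries F ->
  s_sp F = 'i ^ (- n_gm F).
Proof.
move=> _ Fsp _.
have [z [h [m [p [L0 [L1 [L2 [L2' [X2 [Y]]]]]]]]]] := adapted_bases Fsp.
case=> [[eg rkM L0M L1X X2X] [LE kapE LE' XE ZM]].
subst g.
set E := lag0 R _ in LE kapE LE' *.
have Efree : row_free E := lag0_free R _.
have [P Pu PE] := square_coord_unit Efree LE.
have [P' P'u P'E] := square_coord_unit Efree LE'.
have Lfree : row_free (col_mx (col_mx L0 L1) L2) by rewrite /row_free LE (eqP Efree).
have Lfree' : row_free (col_mx (col_mx L0 (L1 *m F)) L2').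
  by rewrite /row_free LE' (eqP Efree).
have Kfree := row_free_col_mx_l Lfree'.
have [|u [v [uvE detv]]] :=
    @flag_basis_change_assoc _ _ _ _ _ L0 L1 (L1 *m F) L2 L2' (P' *m invmx P) Lfree.
  by rewrite P'E PE mulmxA mulmxKV.
have subE : [/\ (L1 <= E)%MS, (L2 <= E)%MS & (L2' <= E)%MS].
  have := submx_refl E; rewrite -{1}LE -addsmxE addsmx_sub -addsmxE addsmx_sub.
  move=> /andP [/andP [_ ->] ->]; have := submx_refl E.
  by rewrite -{1}LE' -addsmxE addsmx_sub => /andP [_ ->].
case: subE => L1E L2E L2'E.
have := det_beta_adapted Fsp Y L0M L1E L1X X2X L2E L2'E uvE.
set Z := col_mx (col_mx L1 L2) (col_mx X2 Y); rewrite -/Z in ZM.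
set beta := symJ R _ *m (F - 1%:M)^T; cbv zeta.
set S := X2 *m beta *m X2^T; set B := L2' *m beta *m L2^T; set G := Y *m beta *m L1^T.
move=> detE.
have ZMfree : row_free (Z *m (F - 1%:M)) by rewrite /row_free ZM rkM.
have Gamma0 : \det (Z *m beta *m Z^T) != 0 := det_star_neq0 Fsp ZMfree ZM.
have detP0 : \det P != 0 by rewrite -unitfE -unitmxE.
have detP'0 : \det P' != 0 by rewrite -unitfE -unitmxE.
have detvE : \det v = \det P' / \det P by rewrite -detv det_mulmx det_inv.
(* Nonsingularity of the star form makes the left side of the identity nonzero, hence every block
   determinant. *)
have : \det G ^+ 2 * \det B * \det S != 0.
  by rewrite -detE detvE !mulf_neq0 ?invr_eq0 ?signr_eq0.
rewrite !mulf_eq0 !negb_or => /andP [/andP [/andP [G0 _] B0] S0].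
have sigE := signature_star_lag0 Fsp L1E L1X X2X XE.
have Ssym : S^T = S by exact: beta_sym_X.
have Su : S \in unitmx by rewrite unitmxE unitfE.
rewrite (exprzi_n_gm sigE Ssym Su rkM Gamma0 (sgn_det_starE Fsp ZMfree ZM)).
have L0F : L0 *m F = L0.
  by apply/eqP; rewrite -subr_eq0 -L0M mulmxBr mulmx1.
(* [L2 F] and [L2 M] differ by [L2], which is orthogonal to [L2'] inside [E]. *)
have BE : L2' *m symJ R _ *m (L2 *m F)^T = B.
  have -> : L2 *m F = L2 *m (F - 1%:M) + L2 by rewrite mulmxBr mulmx1 subrK.
  rewrite trmxD mulmxDr (sub_lag0_iso L2'E L2E) addr0.
  by rewrite trmx_mul /B /beta !mulmxA.
rewrite /s_sp /s_lag -/E.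
have EFfree : row_free (E *m F).
  by rewrite /row_free mxrankMfree ?(eqP Efree) // row_free_unit Sp_unit.
(* [K = (L0, L1 F)] is completed by [L2'] in [E], with matrix [P'], and by [L2 F] in [E F]. The
   latter basis is the [F]-image of [(L0, L1, L2)], so its matrix is [P]. *)
have -> : eps E (E *m F) = sgz (\det P' * \det P * \det (L2' *m symJ R _ *m (L2 *m F)^T)).
  apply: (@eps_sgz _ _ _ _ _ Efree EFfree _ _ (col_mx L0 (L1 *m F))) => //.
  - exact: lag0_iso.
  - by rewrite trmx_mul -!mulmxA (mulmxA _ F^T) !(mulmxA F) Fsp mulmxA lag0_iso.
  - exact/eqmxP.
  - by rewrite mulmxA -PE !mul_col_mx L0F.
  - by rewrite BE.
rewrite BE -kapE (eqP Efree) (eqP Kfree) addKn; congr (_ * _%:~R).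
(* The powers [i^m] agree, so two signs remain; the determinant identity turns their product into a
   nonzero square. *)
apply: sgz_eq_of_mul_gt0.
have -> : \det P' * \det P * \det B * ((-1) ^+ h * \det S * \det (Z *m beta *m Z^T)) =
    \det P ^+ 2 * \det B * \det S * (\det v * (-1) ^+ h * \det (Z *m beta *m Z^T)).
  by rewrite detvE; field.
have -> : \det P ^+ 2 * \det B * \det S *
    (\det v * (-1) ^+ h * \det (Z *m beta *m Z^T)) =
    (\det P * \det G * \det B * \det S) ^+ 2.
  by rewrite detE; ring.
by rewrite exprn_even_gt0 //= !mulf_neq0.
Qed.
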